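(* Let $G=(V,E)$ be a connected simple graph. For each edge $e=uv\in E$ let $V_{<,e}=\{w\in V : d(u,w)<d(v,w)\}$ and $V_{>,e}=\{w\in V : d(u,w)>d(v,w)\}$. Let $MHSP(\{V_{<,e},V_{>,e}\mid e\in E\})$ denote the minimum cardinality of a set $H\subseteq V$ such that $H\cap V_{<,e}\neq\emptyset$ and $H\cap V_{>,e}\neq\emptyset$ for every $e\in E$. Then $\beta_M(G)\geq MHSP(\{V_{<,e},V_{>,e}\mid e\in E\})$.
   Context: For vertices $u,v$, $d(u,v)$ is the number of edges on a shortest $u$–$v$ path. For a vertex $w$ and an edge $e=uv$, $d(w,e)=\min(d(w,u),d(w,v))$. A vertex $w$ resolves two elements $x,y\in V\cup E$ if $d(w,x)\neq d(w,y)$. A set $S\subseteq V$ is a mixed resolving set if every pair of distinct elements of $V\cup E$ is resolved by some element of $S$. The mixed metric dimension $\beta_M(G)$ is the minimum cardinality of a mixed resolving set of $G$. (For an edge $e=uv$, swapping the roles of $u$ and $v$ only swaps $V_{<,e}$ and $V_{>,e}$, so the family is well defined.) *)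

(* Defs.v *)
From HB Require Import structures.
From mathcomp Require Import all_boot.

Set Implicit Arguments.
Unset Strict Implicit.
Unset Printing Implicit Defensive.

Record sgraph (V : finType) := SGraph {
  adj :> rel V;
  adj_sym : symmetric adj;
  adj_irr : irreflexive adj
}.

Definition connected (V : finType) (G : sgraph V) : Prop :=
  forall u v : V, connect G u v.

Definition edges (V : finType) (G : sgraph V) : {set {set V}} :=
  [set e | [exists u, exists v, G u v && (e == [set u; v])]].

Definition has_path (V : finType) (G : sgraph V) (n : nat) (u v : V) : bool :=
  [exists p : n.-tuple V, [&& path G u p, uniq (u :: p) & last u p == v]].

(* A path has fewer than #|V| edges, so the default value #|V| of the minimum
   is reached only when v is not reachable from u; see dist_spec. *)
Definition dist (V : finType) (G : sgraph V) (u v : V) : nat :=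
  \big[minn/#|V|]_(n < #|V| | has_path G n u v) n.

(* On an edge e = uv this is min(d(w,u), d(w,v)); see edist_set2. *)
Definition edist (V : finType) (G : sgraph V) (w : V) (e : {set V}) : nat :=
  \big[minn/#|V|]_(u in e) dist G w u.

Notation element V G := (V + {e : {set V} | e \in edges G})%type (only parsing).

Definition eldist (V : finType) (G : sgraph V) (w : V) (x : element V G) : nat :=
  match x with
  | inl v => dist G w v
  | inr e => edist G w (val e)
  end.

Definition resolves (V : finType) (G : sgraph V) (w : V) (x y : element V G) :=
  eldist w x != eldist w y.

Definition mixed_resolving (V : finType) (G : sgraph V) (S : {set V}) : bool :=
  [forall x : element V G, forall y : element V G,
     (x != y) ==> [exists w in S, resolves w x y]].

(* The minimum cardinality of a set satisfying P, for P satisfied by the full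
   set (see min_cardP); this holds in both uses below, by
   mixed_resolving_setT and hitting_setT. *)
Definition min_card (V : finType) (P : pred {set V}) : nat :=
  #|[arg min_(S < [set: V] | P S) #|S|]|.

Definition mixed_metric_dim (V : finType) (G : sgraph V) : nat :=
  min_card (mixed_resolving G).

Definition hitting (V : finType) (F : {set {set V}}) (H : {set V}) : bool :=
  [forall A in F, H :&: A != set0].

Definition MHSP (V : finType) (F : {set {set V}}) : nat := min_card (hitting F).

Definition V_lt (V : finType) (G : sgraph V) (u v : V) : {set V} :=
  [set w | dist G u w < dist G v w].

Definition V_gt (V : finType) (G : sgraph V) (u v : V) : {set V} :=
  [set w | dist G u w > dist G v w].

(* Both orientations (u, v) and (v, u) of an edge occur here; they contribute
   the same two sets. *)
Definition edge_family (V : finType) (G : sgraph V) : {set {set V}} :=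
  [set A | [exists u, exists v,
     G u v && ((A == V_lt G u v) || (A == V_gt G u v))]].

Lemma bigmin_leq (I : finType) (P : pred I) (F : I -> nat) (m : nat) (i : I) :
  P i -> \big[minn/m]_(j | P j) F j <= F i.
Proof.
have: i \in index_enum I by rewrite mem_index_enum.
elim: (index_enum I) => // j s IH; rewrite inE big_cons => /orP[/eqP<-|si] Pi.
  by rewrite Pi geq_minl.
by case: (P j); [rewrite (leq_trans (geq_minr _ _)) // IH | exact: IH].
Qed.

Lemma bigmin_attained (I : finType) (P : pred I) (F : I -> nat) (m : nat) :
  \big[minn/m]_(j | P j) F j = m \/
  exists2 i, P i & \big[minn/m]_(j | P j) F j = F i.
Proof.
elim/big_rec: _ => [|i x Pi IH]; first by left.
case: (leqP (F i) x) => [_|_]; first by right; exists i.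
exact: IH.
Qed.

Lemma has_path_ltn (V : finType) (G : sgraph V) (n : nat) (u v : V) :
  has_path G n u v -> n < #|V|.
Proof.
case/existsP=> p /and3P[_ Up _].
by have := card_uniqP Up; rewrite /= size_tuple => <-; exact: max_card.
Qed.

Lemma dist_spec (V : finType) (G : sgraph V) (u v : V) : connect G u v ->
  has_path G (dist G u v) u v /\
  (forall n, has_path G n u v -> dist G u v <= n).
Proof.
move=> /connectP[q Gq ->]; case/shortenP: Gq => p Gp Up _.
have hp : has_path G (size p) u (last u p).
  by apply/existsP; exists (in_tuple p); rewrite /= Gp eqxx andbT; apply: Up.
have le n : has_path G n u (last u p) -> dist G u (last u p) <= n.
  move=> hn; exact: (@bigmin_leq _ _ _ _ (Ordinal (has_path_ltn hn)) hn).
split=> //.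
have [E|[i Pi E]] := bigmin_attained
  (fun n : 'I_#|V| => has_path G n u (last u p)) (@nat_of_ord _) #|V|.
  by have := leq_ltn_trans (le _ hp) (has_path_ltn hp); rewrite /dist E ltnn.
by rewrite /dist E.
Qed.

Lemma dist_leq (V : finType) (G : sgraph V) (u v : V) : dist G u v <= #|V|.
Proof.
rewrite /dist; elim/big_ind: _ => // [x y lx ly|i _]; last exact/ltnW.
by rewrite geq_min lx.
Qed.

Lemma edist_set2 (V : finType) (G : sgraph V) (w u v : V) :
  edist G w [set u; v] = minn (dist G w u) (dist G w v).
Proof.
apply/eqP; rewrite eqn_leq /edist leq_min !bigmin_leq ?set21 ?set22 //=.
have [->|[x]] := bigmin_attained (mem [set u; v]) (dist G w) #|V|.
  by rewrite geq_min dist_leq.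
by rewrite /= in_set2 => /orP[]/eqP-> ->; rewrite geq_min leqnn ?orbT.
Qed.

Lemma dist_eq0 (V : finType) (G : sgraph V) (u v : V) :
  (dist G u v == 0) = (u == v).
Proof.
apply/eqP/eqP => [d0|->]; last first.
  have [_ le] := dist_spec (connect0 G v).
  apply/eqP; rewrite -leqn0 le //; apply/existsP; exists [tuple].
  by rewrite /= eqxx.
have [E|[i Pi E]] := bigmin_attained
  (fun n : 'I_#|V| => has_path G n u v) (@nat_of_ord _) #|V|.
  by have /card0_eq/(_ u) : #|V| = 0 by rewrite -E.
have i0 : i = 0 :> nat by rewrite -E.
move: Pi; rewrite i0 => /existsP[p /and3P[_ _ /eqP]].
by rewrite (tuple0 p).
Qed.

Lemma edist_eq0 (V : finType) (G : sgraph V) (w : V) (e : {set V}) :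
  e \in edges G -> (edist G w e == 0) = (w \in e).
Proof.
rewrite inE => /existsP[u /existsP[v /andP[_ /eqP->]]].
by rewrite edist_set2 -leqn0 geq_min !leqn0 !dist_eq0 in_set2.
Qed.

Lemma mixed_resolving_setT (V : finType) (G : sgraph V) :
  mixed_resolving G [set: V].
Proof.
have card_edge (e : {set V}) : e \in edges G -> #|e| = 2.
  rewrite inE => /existsP[u /existsP[v /andP[uv /eqP->]]].
  by rewrite cards2; case: eqP uv => // ->; rewrite adj_irr.
pose elset (x : element V G) : {set V} :=
  match x with inl v => [set v] | inr e => val e end.
have el0 w x : (eldist w x == 0) = (w \in elset x).
  by case: x => [v|e] /=; rewrite ?dist_eq0 ?in_set1 ?edist_eq0 ?(valP e).
have inj : injective elset.
  move=> [v|e] [v'|e'] /= E.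
  - by rewrite (set1_inj E).
  - by have := card_edge _ (valP e'); rewrite /= -E cards1.
  - by have := card_edge _ (valP e); rewrite /= E cards1.
  - by congr inr; apply: val_inj.
apply/forallP=> x; apply/forallP=> y; apply/implyP; apply: contraNT.
rewrite negb_exists => /forallP h; apply/eqP/inj/setP=> w.
by have := h w; rewrite inE /= negbK -!el0 => /eqP->.
Qed.

Lemma hitting_setT (V : finType) (G : sgraph V) :
  hitting (edge_family G) [set: V].
Proof.
apply/forall_inP=> A; rewrite inE => /existsP[u /existsP[v /andP[uv AE]]].
have nuv : u != v by apply: contraTneq uv => ->; rewrite adj_irr.
have d0 w : dist G w w = 0 by apply/eqP; rewrite dist_eq0.
rewrite setTI; apply/set0Pn.
case/orP: AE => /eqP->; [exists u | exists v]; rewrite inE d0 lt0n dist_eq0 //.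
by rewrite eq_sym.
Qed.

Lemma min_cardP (V : finType) (P : pred {set V}) : P [set: V] ->
  (exists2 S, P S & min_card P = #|S|) /\
  (forall S, P S -> min_card P <= #|S|).
Proof.
by move=> PT; rewrite /min_card; case: arg_minnP => // S PS le; split=> //; exists S.
Qed.

(* Main.v *)
(* A vertex w resolves the endpoint v from the edge e = uv exactly when
   d(w,u) < d(w,v); so a mixed resolving set, which must separate e from each
   of its endpoints, meets both sets attached to e. *)
Require Import Defs.
From mathcomp Require Import all_boot.

(** Reversing a path keeps its length and the distinctness of its vertices, and adjacency is
    symmetric. As a path is stored without its start, [belast] drops the old endpoint, which becomes
    the new start. *)
Lemma has_path_sym (V : finType) (G : sgraph V) (n : nat) (u v : V) :
  has_path G n u v = has_path G n v u.
Proof.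
suff rev_has_path x y : has_path G n x y -> has_path G n y x.
  by apply/idP/idP; apply: rev_has_path.
case/existsP=> p /and3P[Gp Up /eqP lp].
have sz : size (rev (belast x p)) == n by rewrite size_rev size_belast size_tuple.
have rev_p : y :: rev (belast x p) = rev (x :: p).
  by rewrite [x :: p]lastI rev_rcons lp.
apply/existsP; exists (Tuple sz); rewrite /= -cons_uniq rev_p rev_uniq Up /=.
rewrite -lp rev_path (eq_path (e' := G)) ?Gp; last by move=> a b; apply: adj_sym.
by rewrite -(last_cons x) lp rev_p rev_cons last_rcons eqxx.
Qed.

Lemma dist_sym (V : finType) (G : sgraph V) (u v : V) : dist G u v = dist G v u.
Proof. by apply: eq_bigl => n; rewrite has_path_sym. Qed.

(** The distance from [w] to the edge is a minimum, so it differs from [dist G w v] only when [u] is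
    strictly closer. *)
Lemma resolves_edge_endpoint (V : finType) (G : sgraph V) (w u v : V)
    (uvE : [set u; v] \in edges G) :
  resolves w (inl v : element V G) (inr (exist _ [set u; v] uvE)) =
  (w \in V_lt G u v).
Proof.
rewrite /resolves /= edist_set2 inE ![dist G _ w]dist_sym.
by case: ltngtP => [/ltn_eqF|_|->]; rewrite ?eqxx // eq_sym => ->.
Qed.

Lemma mixed_resolving_V_lt (V : finType) (G : sgraph V) (S : {set V})
    (u v : V) :
  mixed_resolving G S -> G u v -> S :&: V_lt G u v != set0.
Proof.
move=> resS Guv; have uvE : [set u; v] \in edges G.
  by rewrite inE; apply/existsP; exists u; apply/existsP; exists v; rewrite Guv /=.
pose e : {e : {set V} | e \in edges G} := Sub [set u; v] uvE.
(* A vertex and an edge are distinct by their constructors, so the premise of the implication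
   computes to [true]. *)
have /forallP/(_ (inr e))/existsP[w] := forallP resS (inl v).
rewrite resolves_edge_endpoint => /andP[wS w_lt].
by apply/set0Pn; exists w; rewrite inE wS.
Qed.

Lemma mixed_resolving_hitting (V : finType) (G : sgraph V) (S : {set V}) :
  mixed_resolving G S -> hitting (edge_family G) S.
Proof.
move=> resS; apply/forall_inP => A; rewrite inE.
case/existsP=> u /existsP[v /andP[Guv /orP[]/eqP->]].
  by apply: mixed_resolving_V_lt.
(* [V_gt G u v] is [V_lt G v u] by definition, so the other endpoint is handled by reversing the
   edge. *)
by apply: (@mixed_resolving_V_lt _ _ _ v u); rewrite // adj_sym.
Qed.

Theorem theorem3 (V : finType) (G : sgraph V) (connG : connected G) :
  mixed_metric_dim G >= MHSP (edge_family G).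
Proof.
have [[S resS dimE] _] := min_cardP (mixed_resolving_setT G).
have [_ MHSP_le] := min_cardP (hitting_setT G).
by rewrite /mixed_metric_dim dimE; apply/MHSP_le/mixed_resolving_hitting.
Qed.
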